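(* The Möbius inversion preserves the lines of principal curvature of surfaces in $\mathbb{R}^3_1$; that is, if $S\subset\mathbb{R}^3_1$ is a surface and $C\subset S\setminus LC$ is a line of principal curvature of $S$, then $i_M(C)$ is a line of principal curvature of the surface $i_M(S\setminus LC)$.
   Context: The Minkowski 3-space $\mathbb{R}^3_1$ is $\mathbb{R}^3$ with the pseudo-scalar product $\langle u,v\rangle = u_0v_0+u_1v_1-u_2v_2$. The light cone is $LC=\{p : \langle p,p\rangle=0\}$. The Möbius inversion is the map $i_M:\mathbb{R}^3_1\setminus LC\to\mathbb{R}^3_1\setminus LC$, $i_M(p)=p/\langle p,p\rangle$; it is a diffeomorphism with $i_M^{-1}=i_M$. A surface is a smooth regular surface in $\mathbb{R}^3_1$. For a local parametrization $\mathbf{x}:U\subset\mathbb{R}^2\to\mathbb{R}^3_1$ of a surface, put $E=\langle\mathbf{x}_u,\mathbf{x}_u\rangle$, $F=\langle\mathbf{x}_u,\mathbf{x}_v\rangle$, $G=\langle\mathbf{x}_v,\mathbf{x}_v\rangle$, and $$\bar l=\langle\mathbf{x}_u\times\mathbf{x}_v,\mathbf{x}_{uu}\rangle,\quad \bar m=\langle\mathbf{x}_u\times\mathbf{x}_v,\mathbf{x}_{uv}\rangle,\quad \bar n=\langle\mathbf{x}_u\times\mathbf{x}_v,\mathbf{x}_{vv}\rangle,$$ where $\times$ is the Minkowski cross product, characterized by $\langle a\times b,c\rangle=\det(a,b,c)$. The lines of principal curvature of the surface (including at points where the induced metric is degenerate) are the solution curves (integral curves) of the binary differential equation $$(G\bar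 m-F\bar n)\,dv^2+(G\bar l-E\bar n)\,du\,dv+(F\bar l-E\bar m)\,du^2=0.$$ At points where the induced metric is non-degenerate ($F^2-EG\neq0$), these are the integral curves of the principal directions, i.e. of the eigenvectors of the shape operator $-dN$, with $N=\mathbf{x}_u\times\mathbf{x}_v/\|\mathbf{x}_u\times\mathbf{x}_v\|$ and $\|w\|=\sqrt{|\langle w,w\rangle|}$. *)

(* Defs.v *)
From HB Require Import structures.
From mathcomp Require Import all_boot all_order all_algebra.
From mathcomp Require Import all_classical all_reals all_analysis.
From mathcomp Require Import ring.

Set Implicit Arguments.
Unset Strict Implicit.
Unset Printing Implicit Defensive.

Import Order.TTheory GRing.Theory Num.Theory.
Import numFieldNormedType.Exports.

Local Open Scope classical_set_scope.
Local Open Scope ring_scope.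

(* 'rV[R]_3 carries the Euclidean topology; the Minkowski form only enters
   through the pseudo-scalar product mdot. *)

Definition coord (R : realType) (n : nat) (p : 'rV[R]_n.+1) (i : nat) : R :=
  p ord0 (inord i).

Definition mdot (R : realType) (p q : 'rV[R]_3) : R :=
  coord p 0 * coord q 0 + coord p 1 * coord q 1 - coord p 2 * coord q 2.

Definition light_cone (R : realType) : set 'rV[R]_3 := [set p | mdot p p = 0].

Definition moebius (R : realType) (p : 'rV[R]_3) : 'rV[R]_3 :=
  (mdot p p)^-1 *: p.

Definition row3 (R : realType) (a b c : R) : 'rV[R]_3 :=
  \row_(i < 3) [:: a; b; c]`_i.

(* The sign of the last entry is the one imposed by the signature of mdot; see
   mdot_mcross for the characteristic property. *)
Definition mcross (R : realType) (p q : 'rV[R]_3) : 'rV[R]_3 :=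
  row3 (coord p 1 * coord q 2 - coord p 2 * coord q 1)
       (coord p 2 * coord q 0 - coord p 0 * coord q 2)
       (- (coord p 0 * coord q 1 - coord p 1 * coord q 0)).

Definition mx3 (R : realType) (a b c : 'rV[R]_3) : 'M[R]_3 :=
  \matrix_(i < 3, j < 3) coord ([:: a; b; c]`_i) j.

Lemma coord_row3 (R : realType) (a b c : R) (i : nat) : (i < 3)%N ->
  coord (row3 a b c) i = [:: a; b; c]`_i.
Proof. by move=> i3; rewrite /coord mxE inordK. Qed.

Lemma mdot_mcross (R : realType) (a b c : 'rV[R]_3) :
  mdot (mcross a b) c = \det (mx3 a b c).
Proof.
rewrite /mdot /mcross !coord_row3 //=.
rewrite (expand_det_row _ ord0) !big_ord_recl big_ord0 /cofactor.
rewrite !(expand_det_row _ ord0) !big_ord_recl !big_ord0 /cofactor !det_mx11.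
by rewrite !mxE /= /bump /=; ring.
Qed.

Lemma mcross_unique (R : realType) (a b w : 'rV[R]_3) :
  (forall c, mdot w c = \det (mx3 a b c)) -> w = mcross a b.
Proof.
move=> wE; have {}wE c : mdot w c = mdot (mcross a b) c.
  by rewrite wE mdot_mcross.
have mdotE c : mdot w c - mdot (mcross a b) c = 0 by rewrite wE subrr.
have e0 : coord w 0 = coord (mcross a b) 0.
  apply/eqP; rewrite -subr_eq0 -(mdotE (row3 1 0 0)) /mdot.
  by rewrite !(@coord_row3 R 1 0 0) //=; apply/eqP; ring.
have e1 : coord w 1 = coord (mcross a b) 1.
  apply/eqP; rewrite -subr_eq0 -(mdotE (row3 0 1 0)) /mdot.
  by rewrite !(@coord_row3 R 0 1 0) //=; apply/eqP; ring.
have e2 : coord w 2 = coord (mcross a b) 2.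
  apply/eqP; rewrite eq_sym -subr_eq0 -(mdotE (row3 0 0 1)) /mdot.
  by rewrite !(@coord_row3 R 0 0 1) //=; apply/eqP; ring.
apply/rowP => i; rewrite -[i]inord_val.
by case: i => [[|[|[|//]]]] lt_i3; [exact: e0 | exact: e1 | exact: e2].
Qed.

(* f is of class C^k on U, which is meant to be open: only the values of f on U
   then matter.  The order k.+1 asks for all directional derivatives of f to be
   C^k on U, which amounts to asking it for the partial derivatives. *)
Fixpoint Ck_on (R : realType) (V W : normedModType R) (k : nat) (U : set V)
    (f : V -> W) : Prop :=
  match k with
  | 0 => forall p, U p -> {for p, continuous f}
  | k'.+1 => (forall p, U p -> differentiable f p) /\
             (forall v, Ck_on k' U (fun p => 'D_v f p))
  end.

Definition smooth_on (R : realType) (V W : normedModType R) (U : set V)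
    (f : V -> W) : Prop := forall k, Ck_on k U f.

(* x restricted to U is a local parametrization of S: a smooth immersion which is
   a homeomorphism onto a relatively open subset of S. *)
Definition local_parametrization (R : realType) (S : set 'rV[R]_3)
    (U : set 'rV[R]_2) (x : 'rV[R]_2 -> 'rV[R]_3) : Prop :=
  [/\ open U,
      smooth_on U x,
      (forall q, U q -> injective ('d x q : 'rV[R]_2 -> 'rV[R]_3)),
      (exists2 V : set 'rV[R]_3, open V & x @` U = S `&` V) &
      (exists2 y : 'rV[R]_3 -> 'rV[R]_2,
         (forall q, U q -> y (x q) = q) & {within x @` U, continuous y})].

Definition regular_surface (R : realType) (S : set 'rV[R]_3) : Prop :=
  forall p, S p -> exists (U : set 'rV[R]_2) (x : 'rV[R]_2 -> 'rV[R]_3),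
    local_parametrization S U x /\ (x @` U) p.

Section FundamentalForms.
Context (R : realType) (x : 'rV[R]_2 -> 'rV[R]_3).

Definition e_u : 'rV[R]_2 := delta_mx ord0 (inord 0).
Definition e_v : 'rV[R]_2 := delta_mx ord0 (inord 1).

Definition x_u (q : 'rV[R]_2) : 'rV[R]_3 := 'D_e_u x q.
Definition x_v (q : 'rV[R]_2) : 'rV[R]_3 := 'D_e_v x q.
Definition x_uu (q : 'rV[R]_2) : 'rV[R]_3 := 'D_e_u x_u q.
Definition x_uv (q : 'rV[R]_2) : 'rV[R]_3 := 'D_e_v x_u q.
Definition x_vv (q : 'rV[R]_2) : 'rV[R]_3 := 'D_e_v x_v q.

Definition E_ q := mdot (x_u q) (x_u q).
Definition F_ q := mdot (x_u q) (x_v q).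
Definition G_ q := mdot (x_v q) (x_v q).

Definition lbar q := mdot (mcross (x_u q) (x_v q)) (x_uu q).
Definition mbar q := mdot (mcross (x_u q) (x_v q)) (x_uv q).
Definition nbar q := mdot (mcross (x_u q) (x_v q)) (x_vv q).

Definition principal_bde (q w : 'rV[R]_2) : Prop :=
  let du := coord w 0 in let dv := coord w 1 in
  (G_ q * mbar q - F_ q * nbar q) * dv ^+ 2
  + (G_ q * lbar q - E_ q * nbar q) * (du * dv)
  + (F_ q * lbar q - E_ q * mbar q) * du ^+ 2 = 0.

End FundamentalForms.

(* alpha is, near t, a regular C^1 curve in U solving the binary differential
   equation of x. *)
Definition solution_near (R : realType) (U : set 'rV[R]_2)
    (x : 'rV[R]_2 -> 'rV[R]_3) (alpha : R -> 'rV[R]_2) (t : R) : Prop :=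
  \forall s \near t,
    [/\ U (alpha s),
        derivable alpha s 1,
        {for s, continuous (derive1 alpha)},
        derive1 alpha s != 0 &
        principal_bde x (alpha s) (derive1 alpha s)].

(* C is the trace of a curve gamma in S, defined on an open interval, which in
   each local parametrization of S is locally the image of a solution curve.
   When S is a regular surface, gamma is therefore a regular C^1 curve. *)
Definition line_of_principal_curvature (R : realType) (S C : set 'rV[R]_3) :
    Prop :=
  exists (I : set R) (gamma : R -> 'rV[R]_3),
    [/\ open I, is_interval I & I !=set0] /\
    [/\ gamma @` I = C, C `<=` S &
        forall U x t, local_parametrization S U x -> I t ->
          (x @` U) (gamma t) ->
          exists2 alpha : R -> 'rV[R]_2,
            solution_near U x alpha t &
            \forall s \near t, gamma s = x (alpha s)].

(* Main.v *)
(* The differential of the inversion at p is mu * rho, where mu = 1 / <p, p>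
   and rho is the reflection in the plane orthogonal to p, a Minkowski
   isometry of determinant -1. So E, F, G are multiplied by mu^2. The second
   derivatives of y = moebius o x are mu rho(x_ab) + 2 mu^2 <x_a, x_b> rho(x)
   modulo y_u, y_v, so that l, m, n become - mu^3 (l + 2 mu h E, m + 2 mu h F,
   n + 2 mu h G) with h = det (x_u, x_v, x). The terms in h cancel in the
   binary differential equation, which is therefore multiplied by - mu^5. As
   the inversion is an involution off the light cone, a parametrization of the
   inverted surface composed with it parametrizes S, and solution curves for
   the one are solution curves for the other. *)

From Pilot Require Import Defs.
From HB Require Import structures.
From mathcomp Require Import all_boot all_order all_algebra.
From mathcomp Require Import all_classical all_reals all_analysis.
From mathcomp Require Import ring.
(* Imported again because mathcomp's vector.coord shadows coord. *)
Import Pilot.Defs.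

Set Implicit Arguments.
Unset Strict Implicit.
Unset Printing Implicit Defensive.

Import Order.TTheory GRing.Theory Num.Theory.
Import numFieldNormedType.Exports.

Local Open Scope classical_set_scope.
Local Open Scope ring_scope.

(** * Minkowski algebra *)

Section Minkowski.
Context {R : realType}.
Implicit Types (p a b c w : 'rV[R]_3) (k : R).

Lemma coordD a b i : coord (a + b) i = coord a i + coord b i.
Proof. by rewrite /coord mxE. Qed.

Lemma coordN a i : coord (- a) i = - coord a i.
Proof. by rewrite /coord mxE. Qed.

Lemma coordZ k a i : coord (k *: a) i = k * coord a i.
Proof. by rewrite /coord mxE. Qed.

Lemma coord_inj a b :
  coord a 0 = coord b 0 -> coord a 1 = coord b 1 -> coord a 2 = coord b 2 ->
  a = b.
Proof.
move=> e0 e1 e2; apply/rowP => i; rewrite -[i]inord_val.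
by case: i => [[|[|[|//]]]] lt_i3; [exact: e0 | exact: e1 | exact: e2].
Qed.

(** The target is [R^o], the field as a normed module over itself, so that the calculus of bilinear
    maps applies to [mdot]. *)
Lemma mdot_is_bilinear :
  bilinear_for (GRing.Scale.Law.clone _ _ *:%R _)
    (GRing.Scale.Law.clone _ _ *:%R _) (@mdot R : _ -> _ -> R^o).
Proof.
by split=> [b|a] k c d /=; rewrite /mdot !coordD !coordZ /GRing.scale /=; ring.
Qed.

HB.instance Definition _ := bilinear_isBilinear.Build R 'rV[R]_3 'rV[R]_3 R^o
  _ _ (@mdot R) mdot_is_bilinear.

Lemma mdotC a b : mdot a b = mdot b a.
Proof. by rewrite /mdot; ring. Qed.

Lemma mdotDr a b c : mdot a (b + c) = mdot a b + mdot a c.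
Proof. exact: linearDr. Qed.

Lemma mdotZl k a b : mdot (k *: a) b = k * mdot a b.
Proof. exact: linearZl_LR. Qed.

Lemma mdotZr k a b : mdot a (k *: b) = k * mdot a b.
Proof. exact: linearZr_LR. Qed.

Lemma moebiusK p : ~ light_cone p -> moebius (moebius p) = p.
Proof.
move=> /eqP p0; rewrite /moebius mdotZl mdotZr scalerA.
by rewrite [X in X *: _](_ : _ = 1) ?scale1r //; field.
Qed.

Lemma light_cone_moebius p : ~ light_cone p -> ~ light_cone (moebius p).
Proof.
by move=> /eqP p0; apply/eqP; rewrite mdotZl mdotZr !mulf_neq0 ?invr_neq0.
Qed.

(* Reflection in the plane orthogonal to p: the differential of moebius at p
   is [(mdot p p)^-1 *: reflect p]. *)
Definition reflect p a := a + (- (2 * (mdot p p)^-1 * mdot p a)) *: p.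

(** Reflecting changes the sign of [mdot p a], so the second correction along [p] undoes the
    first. *)
Lemma reflectK p : ~ light_cone p -> involutive (reflect p).
Proof.
move=> /eqP p0 a; rewrite /reflect mdotDr mdotZr -addrA.
rewrite -scalerDl [X in X *: _](_ : _ = 0) ?scale0r ?addr0 //.
by field.
Qed.

Lemma mdot_reflect p a b : ~ light_cone p ->
  mdot (reflect p a) (reflect p b) = mdot a b.
Proof.
move=> /eqP p0; rewrite /reflect mdotDr [mdot _ b]mdotC mdotDr.
rewrite !mdotZr [mdot (_ + _) p]mdotC !mdotDr !mdotZr [mdot b a]mdotC.
rewrite [mdot b p]mdotC.
by field.
Qed.

Lemma mdotZ_reflect k p a b : ~ light_cone p ->
  mdot (k *: reflect p a) (k *: reflect p b) = k ^+ 2 * mdot a b.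
Proof. by move=> p0; rewrite mdotZl mdotZr mdot_reflect // mulrA. Qed.

(** A determinant, by [mdot_mcross]; in this form it is convertible with [lbar], [mbar] and
    [nbar]. *)
Definition triple a b c := mdot (mcross a b) c.

Lemma tripleE a b c : triple a b c =
  (coord a 1 * coord b 2 - coord a 2 * coord b 1) * coord c 0 +
  (coord a 2 * coord b 0 - coord a 0 * coord b 2) * coord c 1 +
  (coord a 0 * coord b 1 - coord a 1 * coord b 0) * coord c 2.
Proof. by rewrite /triple /mdot /mcross !coord_row3 //=; ring. Qed.

(** The sign is the determinant of the reflection. *)
Lemma triple_reflect p a b c : ~ light_cone p ->
  triple (reflect p a) (reflect p b) (reflect p c) = - triple a b c.
Proof.
move=> /eqP; rewrite !tripleE /reflect !coordD !coordZ /mdot => p0.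
by field.
Qed.

Lemma tripleZ k a b c :
  triple (k *: a) (k *: b) c = k ^+ 2 * triple a b c.
Proof. by rewrite !tripleE !coordZ; ring. Qed.

Lemma triple_l a b : triple a b a = 0.
Proof. by rewrite tripleE; ring. Qed.

Lemma triple_r a b : triple a b b = 0.
Proof. by rewrite tripleE; ring. Qed.

(** Serves all three coefficients [lbar], [mbar], [nbar]: [a] and [b] are the first derivatives, [c]
    a second derivative, [d] and [e] the choices among [a], [b] that [c] corresponds to. The terms
    in [d] and [e] are tangential and drop out; the one in [reflect p p] survives. *)
Lemma triple_reflect_comb p a b c d e k :
  ~ light_cone p -> triple a b d = 0 -> triple a b e = 0 ->
  triple (k *: reflect p a) (k *: reflect p b)
    (k *: reflect p c - (2 * k ^+ 2 * mdot p e) *: reflect p d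
     - (2 * k ^+ 2 * mdot p d) *: reflect p e
     + (2 * k ^+ 2 * mdot d e) *: reflect p p) =
  - k ^+ 3 * (triple a b c + 2 * k * triple a b p * mdot d e).
Proof.
move=> p0 d0 e0; pose T w := triple (reflect p a) (reflect p b) w.
have T0 w : triple a b w = 0 -> T (reflect p w) = 0.
  by move=> w0; rewrite /T triple_reflect // w0 oppr0.
rewrite tripleZ [X in _ * X](_ : _ = k * T (reflect p c)
    - (2 * k ^+ 2 * mdot p e) * T (reflect p d)
    - (2 * k ^+ 2 * mdot p d) * T (reflect p e)
    + (2 * k ^+ 2 * mdot d e) * T (reflect p p)); last first.
  by rewrite /T !tripleE !(coordD, coordZ, coordN); ring.
by rewrite (T0 d) // (T0 e) // /T !triple_reflect //; ring.
Qed.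

(** The left side is what the Leibniz rule produces in [derive2_moebius]: [b] and [a] are the
    derivatives along the inner and the outer direction, [c] is the second derivative. *)
Lemma reflect_derivative p a b c : ~ light_cone p ->
  (mdot p p)^-1 *: (c + -2 *:
    ((mdot p p)^-1 *: (mdot p b *: a + (mdot p c + mdot b a) *: p) +
     (-2 * (mdot p p)^-1 ^+ 2 * mdot p a) *: (mdot p b *: p))) +
  (-2 * (mdot p p)^-1 ^+ 2 * mdot p a) *:
    (b + -2 *: ((mdot p p)^-1 *: (mdot p b *: p))) =
  (mdot p p)^-1 *: reflect p c -
  (2 * (mdot p p)^-1 ^+ 2 * mdot p a) *: reflect p b -
  (2 * (mdot p p)^-1 ^+ 2 * mdot p b) *: reflect p a +
  (2 * (mdot p p)^-1 ^+ 2 * mdot b a) *: reflect p p.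
Proof.
move=> /eqP p0; rewrite /reflect.
by apply: coord_inj; rewrite !(coordD, coordZ, coordN); field.
Qed.

End Minkowski.

(** * Smooth maps *)

Section Differentiability.
Context {R : realType} {V : normedModType R}.

(** The remainder of the zero linear map vanishes near [p]. Applied to a difference, this makes
    differentiability a local property. *)
Lemma near0_differentiable (W : normedModType R) (h : V -> W) p :
  (\forall q \near p, h q = 0) -> differentiable h p.
Proof.
move=> h0.
have hE : h \o shift p = cst (h p) + (\0 : {linear V -> W}) +o_ 0 id.
  apply/eqaddoP => e /= e0.
  have : \forall y \near (0 : V), h (y + p) = 0.
    by move: h0; rewrite (near_shift 0 p); apply: filterS => y /=;
      rewrite subr0.
  apply: filterS => y /= hy0; rewrite -[X in `|X|]/(h (y + p) - (h p + 0)).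
  by rewrite hy0 (nbhs_singleton h0) !addr0 subr0 normr0 mulr_ge0 // ltW.
have h0c : continuous (\0 : {linear V -> W}) by move=> ?; exact: cvg_cst.
by apply/diff_locallyP; rewrite (diff_unique h0c hE).
Qed.

Lemma near_eq_differentiable (W : normedModType R) (f g : V -> W) p :
  (\forall q \near p, f q = g q) -> differentiable f p -> differentiable g p.
Proof.
move=> fg df; have -> : g = f + (g - f).
  by apply/funext => q /=; rewrite addrC subrK.
apply: differentiableD => //; apply: near0_differentiable.
by apply: filterS fg => q fgq; rewrite -[LHS]/(g q - f q) fgq subrr.
Qed.

Section Bilinear.
Context {V1 V2 W : normedModType R} (B : {bilinear V1 -> V2 -> W}).
Hypothesis Bc : continuous (fun p => B p.1 p.2).

Lemma differentiable_bilin2 (f : V -> V1) (g : V -> V2) p :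
  differentiable f p -> differentiable g p ->
  differentiable (fun q => B (f q) (g q)) p.
Proof.
move=> df dg.
have -> : (fun q => B (f q) (g q)) =
  (fun p => B p.1 p.2) \o (fun q => (f q, g q)) by [].
apply: differentiable_comp; first exact: differentiable_pair.
exact: differentiable_bilin.
Qed.

(** Leibniz rule, by the chain rule through the pairing of [f] and [g]; it is used both for scaling
    and for [mdot]. *)
Lemma derive_bilin2 (f : V -> V1) (g : V -> V2) p v :
  differentiable f p -> differentiable g p ->
  'D_v (fun q => B (f q) (g q)) p = B (f p) ('D_v g p) + B ('D_v f p) (g p).
Proof.
move=> df dg; rewrite !deriveE //; last exact: differentiable_bilin2.
have -> : (fun q => B (f q) (g q)) =
  (fun p => B p.1 p.2) \o (fun q => (f q, g q)) by [].
rewrite diff_comp //; last exact: differentiable_bilin.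
  by rewrite /= diff_bilin //= diff_pair.
exact: differentiable_pair.
Qed.

End Bilinear.

Section Scale.
Context {W : normedModType R}.

Lemma scale_is_bilinear :
  bilinear_for (GRing.Scale.Law.clone _ _ *:%R _)
    (GRing.Scale.Law.clone _ _ *:%R _) (@GRing.scale R W : R^o -> W -> W).
Proof.
split=> [w|c] k a b /=; first by rewrite scalerDl scalerA.
by rewrite scalerDr !scalerA mulrC.
Qed.

HB.instance Definition _ := bilinear_isBilinear.Build R R^o W W
  _ _ (@GRing.scale R W) scale_is_bilinear.

Definition scale_bil : {bilinear R^o -> W -> W} := @GRing.scale R W.

End Scale.
End Differentiability.

(** * Closure properties of maps of class C^k *)

Section Smoothness.
Context {R : realType} {V : normedModType R}.
Implicit Types (U : set V) (k : nat).

(** As [U] is open, equality on [U] is local equality at its points and passes to derivatives.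
    Derivative formulas valid only on [U] can thus be used in inductions on [k]. *)
Lemma Ck_on_eq (W : normedModType R) k U (f g : V -> W) :
  open U -> (forall p, U p -> f p = g p) -> Ck_on k U f -> Ck_on k U g.
Proof.
move=> Uo; elim: k f g => [|k IH] f g fg /=.
  move=> cf p Up; rewrite /prop_for /continuous_at -(fg _ Up).
  apply: cvg_trans (cf p Up); apply: near_eq_cvg.
  by near=> q; apply: fg; near: q; exact: open_nbhs_nbhs.
move=> [df Df]; have fgN p : U p -> \forall q \near p, f q = g q.
  by move=> Up; near=> q; apply: fg; near: q; exact: open_nbhs_nbhs.
split=> [p Up|v].
  by apply: near_eq_differentiable (fgN _ Up) _; exact: df.
by apply: IH (Df v) => p Up; exact/near_eq_derive/fgN.
Unshelve. all: by end_near. Qed.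

Lemma Ck_onS (W : normedModType R) k U (f : V -> W) :
  Ck_on k.+1 U f -> Ck_on k U f.
Proof.
elim: k f => [|k IH] f [df Df].
  by move=> p Up; exact/differentiable_continuous/df.
by split=> // v; exact: IH.
Qed.

Lemma Ck_on_subset (W : normedModType R) k U U' (f : V -> W) :
  U' `<=` U -> Ck_on k U f -> Ck_on k U' f.
Proof.
move=> U'U; elim: k f => [|k IH] f /=; first by move=> cf p /U'U; exact: cf.
by move=> [df Df]; split=> [p /U'U|v]; [exact: df | exact: IH].
Qed.

Lemma Ck_on_cst (W : normedModType R) k U (w : W) : Ck_on k U (cst w).
Proof.
elim: k w => [|k IH] w; first by move=> p _; exact: cvg_cst.
split=> [p _|v]; first exact: differentiable_cst.
have -> : 'D_v (cst w) = cst (0 : W) by apply/funext => p; exact: derive_cst.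
exact: IH.
Qed.

Lemma Ck_on_id k U : Ck_on k U (@id V).
Proof.
case: k => [|k]; first by move=> p _; exact: cvg_id.
split=> [p _|v]; first exact: ex_diff.
have -> : 'D_v (@id V) = cst v by apply/funext => p; exact: derive_id.
exact: Ck_on_cst.
Qed.

Lemma Ck_onD (W : normedModType R) k U (f g : V -> W) :
  open U -> Ck_on k U f -> Ck_on k U g -> Ck_on k U (f + g).
Proof.
move=> Uo; elim: k f g => [|k IH] f g /=.
  by move=> cf cg p Up; apply: continuousD; [exact: cf | exact: cg].
move=> [df Df] [dg Dg]; split=> [p Up|v].
  by apply: differentiableD; [exact: df | exact: dg].
apply: Ck_on_eq (IH _ _ (Df v) (Dg v)) => // p Up.
by rewrite deriveD //; apply: diff_derivable; [exact: df | exact: dg].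
Qed.

(** Induction on [k] for all [f] and [g] at once: the Leibniz rule pairs each map with a derivative
    of the other, and [Ck_onS] lowers the order of the undifferentiated one. *)
Lemma Ck_on_bilin (V1 V2 W : normedModType R) (B : {bilinear V1 -> V2 -> W})
    k U (f : V -> V1) (g : V -> V2) :
  continuous (fun p => B p.1 p.2) -> open U ->
  Ck_on k U f -> Ck_on k U g -> Ck_on k U (fun p => B (f p) (g p)).
Proof.
move=> Bc Uo; elim: k f g => [|k IH] f g.
  move=> cf cg p Up; apply: (@continuous_comp _ _ _ (fun q => (f q, g q))
    (fun p => B p.1 p.2)); last exact: Bc.
  by apply: cvg_pair; [exact: cf | exact: cg].
move=> Cf Cg; have [[df Df] [dg Dg]] := (Cf, Cg).
split=> [p Up|v].
  by apply: differentiable_bilin2; [exact: Bc | exact: df | exact: dg].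
apply: (@Ck_on_eq _ _ _ ((fun p => B (f p) ('D_v g p)) +
  (fun p => B ('D_v f p) (g p)))) => //.
  by move=> p Up; rewrite (derive_bilin2 Bc) //; [exact: df | exact: dg].
by apply: Ck_onD => //; apply: IH; (exact: Ck_onS || exact: Df || exact: Dg).
Qed.

Lemma Ck_onZ (W : normedModType R) k U (f : V -> R^o) (g : V -> W) :
  open U -> Ck_on k U f -> Ck_on k U g -> Ck_on k U (fun p => f p *: g p).
Proof.
exact: (@Ck_on_bilin _ _ _ scale_bil _ _ _ _ (@scale_continuous _ W)).
Qed.

Lemma derive_inv (f : V -> R^o) p v : differentiable f p -> f p != 0 ->
  'D_v (fun q => (f q)^-1 : R^o) p = - (f p) ^- 2 * 'D_v f p.
Proof.
move=> df f0; rewrite !deriveE //; last exact: differentiableV.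
exact: (congr1 (fun h => h v) (diffV df f0)).
Qed.

(** The derivative of [1 / f] involves [1 / f] itself, which is already C^k by induction. *)
Lemma Ck_onV k U (f : V -> R^o) :
  open U -> (forall p, U p -> f p != 0) ->
  Ck_on k U f -> Ck_on k U (fun p => (f p)^-1 : R^o).
Proof.
move=> Uo f0; elim: k => [cf p Up|k IH Cf].
  by apply: continuousV; [exact: f0 | exact: cf].
have [df Df] := Cf; have /IH Ci := Ck_onS Cf.
split=> [p Up|v]; first by apply: differentiableV; [exact: df | exact: f0].
(* The derivative is written with iterated scalings so that [Ck_onZ] suffices. *)
apply: (@Ck_on_eq _ _ _
  (fun p => - 1 *: ((f p)^-1 *: ((f p)^-1 *: 'D_v f p)) : R^o)) => //.
  move=> p Up; rewrite derive_inv //; [|exact: df|exact: f0].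
  by rewrite /GRing.scale /= mulN1r mulNr expr2 invfM mulrA.
exact: Ck_onZ Uo (@Ck_on_cst R^o k U (- 1))
  (Ck_onZ Uo Ci (Ck_onZ Uo Ci (Df v))).
Qed.

End Smoothness.

(** * Smoothness of the inversion off the light cone *)

Section MoebiusSmooth.
Context {R : realType}.

Lemma mdot_continuous :
  continuous (fun p : 'rV[R]_3 * 'rV[R]_3 => mdot p.1 p.2 : R^o).
Proof.
move=> p; have c1 i : {for p, continuous (fun p => coord p.1 i : R^o)}.
  apply: (@continuous_comp _ _ _ fst (fun p => coord p i : R^o)).
    exact: cvg_fst.
  exact: coord_continuous.
have c2 i : {for p, continuous (fun p => coord p.2 i : R^o)}.
  apply: (@continuous_comp _ _ _ snd (fun p => coord p i : R^o)).
    exact: cvg_snd.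
  exact: coord_continuous.
rewrite /continuous_at /mdot; apply: cvgB; first apply: cvgD;
  by apply: cvgM; [exact: c1 | exact: c2].
Qed.

Lemma open_light_coneC : open (~` @light_cone R).
Proof.
pose n (p : 'rV[R]_3) : R^o := mdot p p.
have cn : Ck_on 0 setT n.
  by apply: (Ck_on_bilin (B := @mdot R)); [exact: mdot_continuous |
    exact: openT | exact: Ck_on_id | exact: Ck_on_id].
have -> : ~` @light_cone R = n @^-1` [set r | r != 0].
  by apply/seteqP; split=> p /= /eqP.
by apply: open_comp => [p _|]; [exact: (cn p I) | exact: open_neq].
Qed.

Context {V : normedModType R} (U : set V) (x : V -> 'rV[R]_3).
Hypotheses (Uo : open U) (x0 : forall q, U q -> ~ light_cone (x q)).

Lemma smooth_on_moebius : smooth_on U x -> smooth_on U (@moebius R \o x).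
Proof.
move=> Cx k; apply: Ck_onZ => //; apply: Ck_onV => //.
  by move=> p /x0 /eqP.
by apply: (Ck_on_bilin (B := @mdot R)) => //; exact: mdot_continuous.
Qed.

End MoebiusSmooth.

(** * The fundamental forms of an inverted surface *)

Section MoebiusDerive.
Context {R : realType} {V : normedModType R}.
Implicit Types (x : V -> 'rV[R]_3) (p q v w : V).

Lemma differentiableZfun (W : normedModType R) (f : V -> R^o) (g : V -> W) p :
  differentiable f p -> differentiable g p ->
  differentiable (fun q => f q *: g q) p.
Proof.
exact: (differentiable_bilin2 (B := scale_bil) (@scale_continuous _ W)).
Qed.

Lemma deriveZfun (W : normedModType R) (f : V -> R^o) (g : V -> W) p v :
  differentiable f p -> differentiable g p ->
  'D_v (fun q => f q *: g q) p = f p *: 'D_v g p + 'D_v f p *: g p.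
Proof.
exact: (derive_bilin2 (B := scale_bil) (@scale_continuous _ W)).
Qed.

Lemma differentiable_mdot (f g : V -> 'rV[R]_3) p :
  differentiable f p -> differentiable g p ->
  differentiable (fun q => mdot (f q) (g q) : R^o) p.
Proof. exact: (differentiable_bilin2 (B := @mdot R) mdot_continuous). Qed.

Lemma derive_mdot (f g : V -> 'rV[R]_3) p v :
  differentiable f p -> differentiable g p ->
  'D_v (fun q => mdot (f q) (g q) : R^o) p =
  mdot (f p) ('D_v g p) + mdot ('D_v f p) (g p).
Proof. exact: (derive_bilin2 (B := @mdot R) mdot_continuous). Qed.

Definition inv_mdot x p : R^o := (mdot (x p) (x p))^-1.

Lemma differentiable_inv_mdot x p : differentiable x p -> ~ light_cone (x p) ->
  differentiable (inv_mdot x) p.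
Proof.
move=> dx /eqP x0; apply: differentiableV => //.
exact: differentiable_mdot.
Qed.

Lemma derive_inv_mdot x p v : differentiable x p -> ~ light_cone (x p) ->
  'D_v (inv_mdot x) p = - 2 * inv_mdot x p ^+ 2 * mdot (x p) ('D_v x p).
Proof.
move=> dx /eqP x0; rewrite /inv_mdot derive_inv //;
  last exact: differentiable_mdot.
by rewrite derive_mdot // [mdot ('D_v x p) _]mdotC; field.
Qed.

Lemma differentiable_moebius x p : differentiable x p -> ~ light_cone (x p) ->
  differentiable (@moebius R \o x) p.
Proof.
move=> dx x0; apply: differentiableZfun => //.
exact: differentiable_inv_mdot.
Qed.

Lemma derive_moebius x p v : differentiable x p -> ~ light_cone (x p) ->
  'D_v (@moebius R \o x) p = inv_mdot x p *: reflect (x p) ('D_v x p).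
Proof.
move=> dx x0; rewrite [LHS](deriveZfun v (differentiable_inv_mdot dx x0) dx).
rewrite derive_inv_mdot // /reflect scalerDr scalerA; congr (_ + _ *: _).
by rewrite /inv_mdot; ring.
Qed.

(** The hypotheses on [x] hold near [p], not just at [p], because the formula of [derive_moebius] is
    itself differentiated. *)
Lemma derive2_moebius x p v w :
  (\forall q \near p, differentiable x q /\ ~ light_cone (x q)) ->
  differentiable ('D_v x) p ->
  'D_w ('D_v (@moebius R \o x)) p =
    inv_mdot x p *: reflect (x p) ('D_w ('D_v x) p)
    - (2 * inv_mdot x p ^+ 2 * mdot (x p) ('D_w x p)) *:
      reflect (x p) ('D_v x p)
    - (2 * inv_mdot x p ^+ 2 * mdot (x p) ('D_v x p)) *:
      reflect (x p) ('D_w x p)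
    + (2 * inv_mdot x p ^+ 2 * mdot ('D_v x p) ('D_w x p)) *:
      reflect (x p) (x p).
Proof.
move=> dxN dDx; have [dx x0] := nbhs_singleton dxN.
pose m := inv_mdot x; pose s q : R^o := mdot (x q) ('D_v x q).
(* The first derivative, with [reflect] unfolded into nested scalings ready for the Leibniz rule. *)
pose h q := m q *: ('D_v x q + (- 2) *: (m q *: (s q *: x q))).
have -> : 'D_w ('D_v (@moebius R \o x)) p = 'D_w h p.
  apply: near_eq_derive; apply: filterS dxN => q [dxq xq0].
  rewrite derive_moebius // /h /reflect !scalerA; congr (_ *: (_ + _ *: _)).
  by rewrite /m /inv_mdot /s; ring.
have dm : differentiable m p by exact: differentiable_inv_mdot.
have ds : differentiable s p by exact: differentiable_mdot.
have dsx := differentiableZfun ds dx.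
have dmsx := differentiableZfun dm dsx.
have dc : differentiable (fun q => (- 2) *: (m q *: (s q *: x q))) p.
  exact: differentiableZ.
rewrite (deriveZfun w dm (differentiableD dDx dc)).
rewrite deriveD; [|exact: diff_derivable|exact: diff_derivable].
rewrite deriveZ; last exact: diff_derivable.
rewrite (deriveZfun w dm dsx) (deriveZfun w ds dx) /m derive_inv_mdot //.
rewrite derive_mdot // [mdot ('D_w x p) _]mdotC /s /reflect /inv_mdot.
exact: (reflect_derivative ('D_w x p) ('D_v x p) ('D_w ('D_v x) p) x0).
Qed.

End MoebiusDerive.

(** * Invariance of the binary differential equation *)

Section FundamentalFormsMoebius.
Context {R : realType} (U : set 'rV[R]_2) (x : 'rV[R]_2 -> 'rV[R]_3).
Hypotheses (Uo : open U) (Cx : smooth_on U x).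
Hypothesis x0 : forall q, U q -> ~ light_cone (x q).

Let y := @moebius R \o x.

Lemma principal_bde_moebius q w : U q ->
  principal_bde y q w <-> principal_bde x q w.
Proof.
(* Order two gives differentiability of [x] and of its directional derivatives. *)
move=> Uq; have [dx Dx] := Cx 2.
have dN : \forall p \near q, differentiable x p /\ ~ light_cone (x p).
  near=> p; have Up : U p by near: p; exact: open_nbhs_nbhs.
  by split; [exact: dx | exact: x0].
have dxq := dx _ Uq; have xq0 := x0 Uq.
have dDx v : differentiable ('D_v x) q by have [+ _] := Dx v; exact.
have yuE : x_u y q = inv_mdot x q *: reflect (x q) (x_u x q).
  exact: derive_moebius.
have yvE : x_v y q = inv_mdot x q *: reflect (x q) (x_v x q).
  exact: derive_moebius.
pose m := inv_mdot x q; pose t := triple (x_u x q) (x_v x q) (x q).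
have EE : E_ y q = m ^+ 2 * E_ x q.
  by rewrite /E_ yuE; exact: mdotZ_reflect.
have FE : F_ y q = m ^+ 2 * F_ x q.
  by rewrite /F_ yuE yvE; exact: mdotZ_reflect.
have GE : G_ y q = m ^+ 2 * G_ x q.
  by rewrite /G_ yvE; exact: mdotZ_reflect.
have uuE := derive2_moebius (e_u R) dN (dDx (e_u R)).
have uvE := derive2_moebius (e_v R) dN (dDx (e_u R)).
have vvE := derive2_moebius (e_v R) dN (dDx (e_v R)).
have lE : lbar y q = - m ^+ 3 * (lbar x q + 2 * m * t * E_ x q).
  rewrite /lbar yuE yvE [x_uu y q]uuE.
  by apply: triple_reflect_comb => //; exact: triple_l.
have mE : mbar y q = - m ^+ 3 * (mbar x q + 2 * m * t * F_ x q).
  rewrite /mbar yuE yvE [x_uv y q]uvE.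
  by apply: triple_reflect_comb => //; [exact: triple_l | exact: triple_r].
have nE : nbar y q = - m ^+ 3 * (nbar x q + 2 * m * t * G_ x q).
  rewrite /nbar yuE yvE [x_vv y q]vvE.
  by apply: triple_reflect_comb => //; exact: triple_r.
rewrite /principal_bde.
(* Once the coefficients of [y] are replaced by their expressions, only a polynomial identity is
   left. *)
move: (E_ y q) (F_ y q) (G_ y q) (lbar y q) (mbar y q) (nbar y q)
  EE FE GE lE mE nE.
move=> _ _ _ _ _ _ -> -> -> -> -> -> /=.
have m0 : - m ^+ 5 != 0.
  by rewrite oppr_eq0 expf_neq0 // invr_eq0; exact/eqP.
set lhs := (X in X = 0 <-> _); set rhs := (X in _ <-> X = 0).
(* The terms in [t] add a multiple of [(E, F, G)] to [(lbar, mbar, nbar)], and the coefficients of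
   the equation are 2 by 2 minors of these two rows. *)
have -> : lhs = - m ^+ 5 * rhs by rewrite /lhs /rhs; ring.
by split=> [/eqP|->]; rewrite ?mulr0 // mulf_eq0 (negPf m0) => /eqP.
Unshelve. all: by end_near. Qed.

End FundamentalFormsMoebius.

(** * Inverted surfaces and their lines of curvature *)

Section Inversion.
Context {R : realType}.
Implicit Types (S : set 'rV[R]_3) (U : set 'rV[R]_2) (x : 'rV[R]_2 -> 'rV[R]_3).

Definition inverted S := @moebius R @` (S `\` @light_cone R).

Lemma inverted_light_cone S p : inverted S p -> ~ light_cone p.
Proof. by move=> [q [_ q0] <-]; exact: light_cone_moebius. Qed.

Lemma invertedK S : inverted (inverted S) = S `\` @light_cone R.
Proof.
apply/seteqP; split=> [_ [_ [[p [Sp p0] <-] _] <-]|p [Sp p0]].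
  by rewrite moebiusK.
exists (moebius p); last exact: moebiusK.
by split; [exists p | exact: light_cone_moebius].
Qed.

Lemma moebius_continuous p : ~ light_cone p -> {for p, continuous (@moebius R)}.
Proof.
move=> p0; apply: differentiable_continuous.
exact: (@differentiable_moebius R _ id p ex_diff p0).
Qed.

(** Intersecting with [A] matters because [f] is continuous only at the points of [A], as the
    inversion is only off the light cone. *)
Lemma open_setI_preimage (T T' : topologicalType) (A : set T) (W : set T')
    (f : T -> T') :
  open A -> (forall p, A p -> {for p, continuous f}) -> open W ->
  open (A `&` f @^-1` W).
Proof.
rewrite !openE => Ao cf Wo p [Ap Wp].
by apply: filterI; [exact: Ao | exact: (cf p Ap _ (Wo _ Wp))].
Qed.

(** The differential stays injective since the reflection is an involution and its factor is
    nonzero; [V] is replaced by its preimage under the inversion, and the inverse chart [y] by [y]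
    after the inversion. *)
Lemma local_parametrization_inverted S U x :
  local_parametrization S U x ->
  local_parametrization (inverted S) (U `&` x @^-1` (~` @light_cone R))
    (@moebius R \o x).
Proof.
move=> [Uo Cx inj [V Vo xUV] [y yK yc]].
have dx q : U q -> differentiable x q by have [+ _] := Cx 1; exact.
have U'o : open (U `&` x @^-1` (~` @light_cone R)).
  apply: (open_setI_preimage Uo _ open_light_coneC) => q Uq.
  exact/differentiable_continuous/dx.
have x'E : (@moebius R \o x) @` (U `&` x @^-1` (~` @light_cone R)) =
    inverted S `&` (~` @light_cone R `&` @moebius R @^-1` V).
  apply/seteqP; split=> [_ [q [Uq q0] <-]|_ [[p [Sp p0] <-] [_ /= Vp]]].
    have [Sq Vq] : (S `&` V) (x q) by rewrite -xUV; exists q.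
    split; first by exists (x q).
    by split; [exact: light_cone_moebius | rewrite /= moebiusK].
  have [q Uq qp] : (x @` U) p by rewrite xUV; split; rewrite // -[p]moebiusK.
  by exists q; [split; rewrite //= qp | rewrite /= qp].
split=> //.
- apply: smooth_on_moebius => // [q []//|k].
  by apply: Ck_on_subset (Cx k); exact: subIsetl.
- move=> q [Uq q0] v w vw.
  have dq := dx _ Uq; have dMq := differentiable_moebius dq q0.
  have dE u : 'd (@moebius R \o x) q u =
      inv_mdot x q *: reflect (x q) ('d x q u).
    apply: etrans (esym (deriveE u dMq)) _.
    apply: etrans (derive_moebius u dq q0) _.
    by congr (_ *: reflect _ _); exact: deriveE.
  have {}vw := etrans (esym (dE v)) (etrans vw (dE w)).
  apply: (inj _ Uq); rewrite -[LHS](reflectK q0) -[RHS](reflectK q0).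
  congr (reflect _); apply: scalerI vw.
  by rewrite invr_eq0; exact/eqP.
- exists (~` @light_cone R `&` @moebius R @^-1` V) => //.
  exact: (open_setI_preimage open_light_coneC (@moebius_continuous) Vo).
- exists (y \o @moebius R) => [q [Uq q0]|]; first by rewrite /= moebiusK // yK.
  move/subspace_continuousP: yc => yc; apply/subspace_continuousP.
  move=> _ [q [Uq q0] <-] W Wq.
  have {}Wq : nbhs (y (x q)) W by rewrite -[x q]moebiusK.
  have cM : @moebius R @ moebius (x q) --> x q.
    have := @moebius_continuous (moebius (x q)) (light_cone_moebius q0).
    by rewrite /prop_for /continuous_at moebiusK.
  (* Continuity of [y] holds only within the image of [x]; this relative neighbourhood is pulled
     back by the inversion. *)
  have WM : nbhs (moebius (x q))
      [set p | (x @` U) (moebius p) -> W (y (moebius p))].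
    exact: (cM _ (yc _ (ex_intro2 _ _ q Uq erefl) W Wq)).
  refine (filterS _ WM) => p /= Wp [r [Ur r0] rp]; apply: Wp.
  by rewrite -rp /= moebiusK //; exists r.
Qed.

(** The complement of the light cone is open, so relatively open subsets of the smaller set are
    relatively open in [S]. *)
Lemma local_parametrization_setD S U x :
  local_parametrization (S `\` @light_cone R) U x ->
  local_parametrization S U x.
Proof.
move=> [Uo Cx inj [V Vo xUV] yc]; split=> //.
exists (~` @light_cone R `&` V).
  by apply: openI => //; exact: open_light_coneC.
by rewrite xUV setDE setIA.
Qed.

Lemma regular_surface_inverted S :
  regular_surface S -> regular_surface (inverted S).
Proof.
move=> surfS _ [p [Sp p0] <-]; have [U [x [Sx [q Uq qp]]]] := surfS _ Sp.
exists (U `&` x @^-1` (~` @light_cone R)), (@moebius R \o x); split.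
  exact: local_parametrization_inverted.
by exists q; [split; rewrite //= qp | rewrite /= qp].
Qed.

Lemma solution_near_moebius U x (alpha : R -> 'rV[R]_2) t :
  open U -> smooth_on U x -> (forall q, U q -> ~ light_cone (x q)) ->
  solution_near U (@moebius R \o x) alpha t -> solution_near U x alpha t.
Proof.
move=> Uo Cx x0; apply: filterS => s [Us ds cs ns bs].
split; [exact: Us | exact: ds | exact: cs | exact: ns |].
exact: (principal_bde_moebius Uo Cx x0 _ Us).1 bs.
Qed.

(** Any parametrization [x] of the inverted surface yields the parametrization [moebius \o x] of
    [S]; the curve [alpha] that the hypothesis provides for it also serves for [x]. *)
Lemma line_of_principal_curvature_inverted S C :
  C `<=` S `\` @light_cone R -> line_of_principal_curvature S C ->
  line_of_principal_curvature (inverted S) (@moebius R @` C).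
Proof.
move=> CS [I [gamma [Iitv [gammaC _ lineC]]]].
exists I, (@moebius R \o gamma); split=> //; split.
- by rewrite -gammaC image_comp.
- by move=> _ [p /CS Sp <-]; exists p.
move=> U x t Sx It [q Uq qt].
have [Uo Cx _ [V _ xUV] _] := Sx.
have x0 r : U r -> ~ light_cone (x r).
  move=> Ur; have [+ _] : (inverted S `&` V) (x r) by rewrite -xUV; exists r.
  exact: inverted_light_cone.
have S'x : local_parametrization S U (@moebius R \o x).
  apply: local_parametrization_setD; rewrite -invertedK.
  (* [x] already avoids the light cone on [U], so the restricted domain is [U] itself. *)
  have -> : U = U `&` x @^-1` (~` @light_cone R) by rewrite setIidl.
  exact: local_parametrization_inverted.
have Ct s : I s -> ~ light_cone (gamma s).
  move=> Is; have [] // : (S `\` @light_cone R) (gamma s).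
  by apply/CS; rewrite -gammaC; exists s.
have [|alpha sol gammaE] := lineC _ _ t S'x It.
  by exists q => //=; rewrite qt /= moebiusK //; exact: Ct.
exists alpha; first exact: (solution_near_moebius Uo Cx x0 sol).
(* That [alpha s] lies in [U] is needed to cancel the double inversion. *)
apply: filterS2 sol gammaE => s [Us _ _ _ _] /= ->.
by rewrite moebiusK //; exact: x0.
Qed.

End Inversion.

Theorem theorem3p2 (R : realType) (S C : set 'rV[R]_3)
    (surfS : regular_surface S)
    (CS : C `<=` S `\` @light_cone R)
    (lineC : line_of_principal_curvature S C) :
  regular_surface (@moebius R @` (S `\` @light_cone R)) /\
  line_of_principal_curvature (@moebius R @` (S `\` @light_cone R))
                              (@moebius R @` C).
Proof.
by split; [exact: regular_surface_inverted |
  exact: line_of_principal_curvature_inverted].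
Qed.
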